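(* Suppose $X=(\mathbb{P}^a)^{\times w}$ for an integer $a$, let $L$ be a very ample line bundle on $X$, and let $F\in H^0(X,L)^*$ be a partially symmetric tensor of minimal border rank (that is, $F$ is concise and its $X$-border rank equals $a+1$). Then the apolar ideal $\mathrm{Ann}(F)\subset S$ has at least $a$ (which equals the $X$-border rank of $F$ minus $1$) minimal generators in degree $L$.
   Context: The base field is $\mathbb{C}$. $S=\bigoplus_{D\in\mathbb{Z}^w}H^0(X,\mathcal{O}_X(D))=\mathbb{C}[\alpha_{i,j}\mid 1\le i\le w,\ 0\le j\le a]$ is the Cox ring of $X$, $\mathbb{Z}^w$-graded with $\deg\alpha_{i,j}=e_i$ (standard basis vector). $X\subset\mathbb{P}(H^0(X,L)^* )$ is embedded by the complete linear system of $L$ (Segre–Veronese embedding). The $X$-border rank of $F$ is the least $r$ such that $[F]$ lies in the closure of the union of linear spans of $r$-tuples of points of $X$. For $\Theta\in S_D$, $\Theta\lrcorner F\in H^0(L-D)^*$ is the functional $\Psi\mapsto F(\Theta\Psi)$; $\mathrm{Ann}(F)=\{\Theta\in S\mid\Theta\lrcorner F=0\}$, a homogeneous ideal. $F$ is concise if $\mathrm{Ann}(F)_{e_i}=0$ for all $i$. In general, $F$ has minimal border rank if it is concise and its border rank equals the maximum of $\dim H^0(\deg\alpha)$ over all variables $\alpha$ of $S$; here this maximum is $a+1$. The number of minimal generators of a homogeneous ideal $J$ in degree $L$ is $\dim\big(J_L/(\mathfrak mJ)_L\big)$, where $\mathfrak m$ is the ideal generated by all variables of $S$. *)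

(* Defs.v *)
From HB Require Import structures.
From mathcomp Require Import all_boot all_order all_algebra.
From mathcomp Require Import mpoly.

Set Implicit Arguments.
Unset Strict Implicit.
Unset Printing Implicit Defensive.

Import GRing.Theory.
Local Open Scope ring_scope.

(* The Cox ring of (P^a)^w: the variable alpha_{i,j} is 'X_(mxvec_index i j). *)
Notation cox K w a := {mpoly K[w * a.+1]}.

Section CoxRing.
Variables (K : fieldType) (w a : nat).
Local Notation S := (cox K w a).

(* Elements of the grading group Z^w = Pic X are row vectors. *)
Definition mdegree (m : 'X_{1.. w * a.+1}) : 'rV[int]_w :=
  \row_i (\sum_(j < a.+1) m (mxvec_index i j))%:Z.

Definition mhomog (D : 'rV[int]_w) : {pred S} :=
  fun p => all (fun m => mdegree m == D) (msupp p).

Lemma mhomogP D (p : S) :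
  reflect {in msupp p, forall m, mdegree m = D} (p \in mhomog D).
Proof. by apply: (iffP allP) => h m /h => [/eqP|->]. Qed.

Fact mhomog_submod_closed D : submod_closed (mhomog D).
Proof.
split=> [|c p q /mhomogP hp /mhomogP hq]; first by apply/mhomogP=> m; rewrite msupp0.
apply/mhomogP => m /msuppD_le; rewrite mem_cat => /orP[/msuppZ_le|]; [exact: hp|exact: hq].
Qed.

HB.instance Definition _ D :=
  GRing.isSubmodClosed.Build K S (mhomog D) (mhomog_submod_closed D).

Lemma mdegreeD (m1 m2 : 'X_{1.. w * a.+1}) :
  mdegree (m1 + m2)%MM = mdegree m1 + mdegree m2.
Proof.
apply/rowP => i; rewrite !mxE -PoszD -big_split /=; congr Posz.
by apply: eq_bigr => j _; rewrite mnmDE.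
Qed.

Lemma mhomogM D E (p q : S) :
  p \in mhomog D -> q \in mhomog E -> p * q \in mhomog (D + E).
Proof.
move=> /mhomogP hp /mhomogP hq; apply/mhomogP => m /msuppM_le /allpairsP[[m1 m2] /=].
by case=> h1 h2 ->; rewrite mdegreeD hp ?hq.
Qed.

(* S_D = H^0(X, O_X(D)). *)
Record H0 (D : 'rV[int]_w) := MkH0 { sec :> S; _ : sec \in mhomog D }.

HB.instance Definition _ D := [isSub for @sec D].
HB.instance Definition _ D := [Choice of H0 D by <:].
HB.instance Definition _ D := [SubChoice_isSubLmodule of H0 D by <:].

Definition hcomp_poly (D : 'rV[int]_w) (p : S) : S :=
  \sum_(m <- msupp p | mdegree m == D) p@_m *: 'X_[m].

Fact hcomp_subproof D (p : S) : hcomp_poly D p \in mhomog D.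
Proof.
apply: rpred_sum => m /eqP mD; apply: rpredZ.
by apply/mhomogP => m'; rewrite msuppX inE => /eqP ->.
Qed.

Definition hcomp D (p : S) : H0 D := MkH0 (hcomp_subproof D p).

Fact H0mul_subproof L D (p : H0 D) (q : H0 (L - D)) : sec p * sec q \in mhomog L.
Proof.
by have := mhomogM (valP p) (valP q); rewrite (addrC D (L - D)) subrK.
Qed.

Definition H0mul L D (p : H0 D) (q : H0 (L - D)) : H0 L :=
  MkH0 (H0mul_subproof p q).

Definition contract L (F : H0 L -> K) D (Theta : H0 D) : H0 (L - D) -> K :=
  fun Psi => F (H0mul Theta Psi).

(* An arbitrary Theta acts through its homogeneous components, whose
   contractions with F live in different summands H^0(L - D)^*. *)
Definition Ann L (F : H0 L -> K) (Theta : S) : Prop :=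
  forall D (Psi : H0 (L - D)), contract F (hcomp D Theta) Psi = 0.

Definition concise L (F : H0 L -> K) : Prop :=
  forall (i : 'I_w) (Theta : H0 (delta_mx 0 i)), Ann F Theta -> sec Theta = 0.

(* Homogeneous coordinates of a point of X, one row for each factor P^a. *)
Definition is_point (x : 'M[K]_(w, a.+1)) : Prop := forall i, row i x != 0.

Definition ev (p : S) (x : 'M[K]_(w, a.+1)) : K := p.@[fun k => mxvec x 0 k].

(* The differential of p at x, applied to v. *)
Definition dev (p : S) (x v : 'M[K]_(w, a.+1)) : K :=
  \sum_k mxvec v 0 k * ev p^`M(k) x.

Definition rowwise_multiple (x y : 'M[K]_(w, a.+1)) : Prop :=
  forall i, exists c : K, row i x = c *: row i y.

(* The map phi_L : x |-> [s |-> s(x)] to P(H^0(X,L)^* ) given by the complete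
   linear system is everywhere defined, injective, and has injective
   differential.  The tangent space of X at x is the space of matrices v modulo
   those whose rows are multiples of the rows of x; the tangent space of
   P(H^0(X,L)^* ) at phi_L(x) is H^0(X,L)^* modulo the evaluation at x. *)
Definition very_ample (L : 'rV[int]_w) : Prop :=
  [/\ forall x, is_point x -> exists s : H0 L, ev s x != 0,
      forall x y, is_point x -> is_point y ->
        (exists c : K, forall s : H0 L, ev s x = c * ev s y) ->
        rowwise_multiple x y
    & forall x v, is_point x ->
        (exists c : K, forall s : H0 L, dev s x v = c * ev s x) ->
        rowwise_multiple v x].

(* F lies in the affine cone over the span of some r points of X. *)
Definition in_span_of_points L (r : nat) (F : H0 L -> K) : Prop :=
  exists (x : 'I_r -> 'M[K]_(w, a.+1)) (c : 'I_r -> K),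
    (forall k, is_point (x k)) /\ forall s : H0 L, F s = \sum_k c k * ev s (x k).

(* Zariski closure in P(H^0(X,L)^* ): homogeneous polynomial functions on
   H^0(X,L)^* are homogeneous polynomials in finitely many evaluations
   F |-> F s, with s in H^0(X,L). *)
Definition in_secant_variety L (r : nat) (F : {linear H0 L -> K^o}) : Prop :=
  forall (N d : nat) (G : {mpoly K[N]}) (s : 'I_N -> H0 L), G \is d.-homog ->
    (forall F' : {linear H0 L -> K^o}, in_span_of_points r F' ->
       G.@[fun k => F' (s k)] = 0) ->
    G.@[fun k => F (s k)] = 0.

Definition has_border_rank L (F : {linear H0 L -> K^o}) (r : nat) : Prop :=
  in_secant_variety r F /\ forall r', in_secant_variety r' F -> (r <= r')%N.

Definition ideal_gen (A : S -> Prop) (p : S) : Prop :=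
  exists (k : nat) (c g : 'I_k -> S), (forall i, A (g i)) /\ p = \sum_i c i * g i.

Definition ideal_mul (I J : S -> Prop) : S -> Prop :=
  ideal_gen (fun p => exists f g, [/\ I f, J g & p = f * g]).

Definition variables_ideal : S -> Prop :=
  ideal_gen (fun p => exists k, p = 'X_k).

(* dim U / W = n, witnessed by lifts to U of a basis of U / W. *)
Definition quot_dim (V : lmodType K) (U W : V -> Prop) (n : nat) : Prop :=
  exists g : 'I_n -> V,
    [/\ forall k, U (g k),
        forall c : 'I_n -> K, W (\sum_k c k *: g k) -> forall k, c k = 0
      & forall u, U u -> exists c : 'I_n -> K, W (u - \sum_k c k *: g k)].

Definition num_min_gens (J : S -> Prop) (L : 'rV[int]_w) (n : nat) : Prop :=
  @quot_dim (H0 L) (fun p => J p) (fun p => ideal_mul variables_ideal J p) n.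

End CoxRing.

(* Main.v *)
From HB Require Import structures.
Require Import Defs.
From mathcomp Require Import all_boot all_order all_algebra.
From mathcomp Require Import mpoly zify ring.
From mathcomp Require boolp.
From mathcomp Require Import complex reals.

(** Write m for the ideal of the variables.  Since Ann(F)_L is the kernel of F
on S_L, it has codimension at most 1, so the theorem follows once (m Ann(F))_L
has codimension at least a+1 in S_L, that is, once a+1 linearly independent
functionals on S_L vanish on it.

Consider the systems (G, A_1, ..., A_w), with G a functional on S_L and A_i an
endomorphism of S_{e_i}, such that Theta _| G = A_i(Theta) _| F for all i and
all Theta in S_{e_i} ([solution]).  For such a G and Psi in Ann(F)_{L - e_i},
G(Theta Psi) = F(A_i(Theta) Psi) = 0, so G vanishes on (m Ann(F))_L
([solution_kills]).  When F is concise, G = 0 forces every A_i to vanish, so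
independent systems have independent functionals G ([concise_lin_indep]).  It
remains to find a+1 independent systems.

For fixed F the systems form the kernel of a matrix whose entries are
polynomials in F, homogeneous row by row; hence having a kernel of dimension at
least a+1 is given by the vanishing of minors that are homogeneous polynomials
in F, a condition that passes to the Zariski closure ([kernel_dim_ge_closed]).
So it is enough to treat F = sum_k c_k ev_{x_k} with a+1 points x_k
([points_solutions]).  For each i collect the i-th rows of the points into a
square matrix Y_i.  If all the Y_i are invertible, let A_i act on S_{e_i} by
multiplying the value at x_k by d_k, and take G = sum_k d_k c_k ev_{x_k}: the
vectors d give a+1 dimensions.  If some Y_i is singular, a nonzero linear form
Theta in S_{e_i} vanishes at all the points, hence annihilates F; with G = 0
and the other A's zero, A_i may send each of the a+1 variables to any multiple
of Theta.

The independence of these systems is read off one of the A_i, so this covers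
w > 0; when w = 0, X is a point, the border rank is at most 1 and a = 0. *)

Set Implicit Arguments.
Unset Strict Implicit.
Unset Printing Implicit Defensive.
Import GRing.Theory.
Local Open Scope ring_scope.

(** * Kernels of matrices with polynomial entries *)

Section PolynomialMatrices.
Variable K : fieldType.

(** Vectors are functions on an arbitrary type rather than rows of a matrix, so
that the unknowns of the linear system below keep their natural names. *)
Definition lin_indep n (U : Type) (Z : 'I_n -> U -> K) : Prop :=
  forall c : 'I_n -> K, (forall u, \sum_t c t * Z t u = 0) -> forall t, c t = 0.

Lemma lin_indep_row_free n (U : finType) (Z : 'I_n -> U -> K) :
  lin_indep Z <-> row_free (\matrix_(t < n, u < #|U|) Z t (enum_val u)).
Proof.
split=> [hZ|/row_free_inj hZ c hc t].
  apply/inj_row_free => v hv; apply/rowP => t; rewrite mxE.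
  apply: (hZ (v 0)) => u; have /rowP/(_ (enum_rank u)) := hv.
  rewrite !mxE => h; rewrite -[RHS]h; apply: eq_bigr => s _.
  by rewrite mxE enum_rankK.
have /hZ /rowP/(_ t) : (\row_s c s) *m (\matrix_(t < n, u < #|U|) Z t (enum_val u)) =
    0 *m (\matrix_(t < n, u < #|U|) Z t (enum_val u)).
  rewrite mul0mx; apply/rowP => u; rewrite !mxE -[RHS](hc (enum_val u)).
  by apply: eq_bigr => s _; rewrite !mxE.
by rewrite !mxE.
Qed.

(** The left kernel of the matrix Q has dimension at least k. *)
Definition kernel_dim_ge (U E : finType) (Q : U -> E -> K) (k : nat) : Prop :=
  exists Z : 'I_k -> U -> K,
    lin_indep Z /\ forall t e, \sum_u Z t u * Q u e = 0.

Definition fun_mx R (U E : finType) (Q : U -> E -> R) : 'M[R]_(#|U|, #|E|) :=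
  \matrix_(u, e) Q (enum_val u) (enum_val e).

Lemma kernel_dim_ge_rank (U E : finType) (Q : U -> E -> K) k :
  kernel_dim_ge Q k <-> (\rank (fun_mx Q) + k <= #|U|)%N.
Proof.
split=> [[Z [/lin_indep_row_free]]|].
  set A := (X in row_free X) => /eqP rA hZ; rewrite -[k in leqLHS]rA addnC.
  apply: mulmx0_rank_max; apply/matrixP => t e; rewrite !mxE -[RHS](hZ t (enum_val e)).
  rewrite [RHS](reindex (@enum_val _ (mem U))) /=; last exact/onW_bij/enum_val_bij.
  by apply: eq_bigr => u _; rewrite !mxE.
move=> hr; have hk : (k <= \rank (kermx (fun_mx Q)))%N.
  by rewrite mxrank_ker -(leq_add2l (\rank (fun_mx Q))) subnKC ?rank_leq_row.
pose B := rowsub (widen_ord hk) (row_base (kermx (fun_mx Q))).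
exists (fun t u => B t (enum_rank u)); split=> [|t e].
  apply/lin_indep_row_free; set C := (X in row_free X).
  have -> : C = B by apply/matrixP => t u; rewrite mxE enum_valK.
  apply/inj_row_free => v.
  have -> : B = rowsub (widen_ord hk) 1%:M *m row_base (kermx (fun_mx Q)).
    by rewrite mul_rowsub_mx mul1mx.
  rewrite mulmxA => h0.
  have := row_free_inj (row_base_free _) (etrans h0 (esym (mul0mx _ _))).
  move=> /rowP h; apply/rowP => t; move: (h (widen_ord hk t)); rewrite !mxE => <-.
  rewrite (bigD1 t) //= !mxE eqxx mulr1 big1 ?addr0 // => s /negPf st.
  rewrite !mxE; case: eqP => [/(congr1 val) /= /val_inj /eqP|]; rewrite ?st ?mulr0 //.
have : (B *m fun_mx Q) t (enum_rank e) = 0.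
  suff -> : B *m fun_mx Q = 0 by rewrite mxE.
  apply/row_matrixP => s; rewrite row0 row_mul; apply/sub_kermxP.
  by rewrite row_rowsub (submx_trans (row_sub _ _)) // eq_row_base.
rewrite mxE => h; rewrite -[RHS]h.
rewrite [LHS](reindex (@enum_val _ (mem U))) /=; last exact/onW_bij/enum_val_bij.
by apply: eq_bigr => u _; rewrite !mxE enum_valK enum_rankK.
Qed.

Definition in_closure N (P : ('I_N -> K) -> Prop) (v : 'I_N -> K) : Prop :=
  forall d (G : {mpoly K[N]}), G \is d.-homog ->
    (forall v', P v' -> G.@[v'] = 0) -> G.@[v] = 0.

Lemma det_dhomog N n (A : 'M[{mpoly K[N]}]_n) (deg : 'I_n -> nat) :
  (forall i j, A i j \is (deg i).-homog) -> \det A \is (\sum_i deg i).-homog.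
Proof.
move=> hA; apply: rpred_sum => s _; rewrite rpredMsign.
apply: (big_ind2 (fun p d => p \is d.-homog)) => [|p d q e hp hq|i _] //.
  exact: dhomog1.
exact: dhomogM.
Qed.

Lemma unit_minor m n (A : 'M[K]_(m, n)) r : \rank A = r ->
  exists (f : 'I_r -> 'I_m) (g : 'I_r -> 'I_n), mxsub f g A \in unitmx.
Proof.
move=> <-; pose B := rowsub (maxrankfun A) A.
have fullB : row_full B^T by rewrite /row_full mxrank_tr; exact: maxrowsub_free.
pose g := fullrankfun fullB.
exists (maxrankfun A), g.
by have := fullrowsub_unit fullB; rewrite -unitmx_tr trmx_mxsub trmxK -mxsub_comp.
Qed.

(** Semicontinuity of the kernel dimension.  A nonvanishing minor of size the
rank at v is a homogeneous polynomial, because rows are homogeneous, so it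
cannot vanish at all the points of P; where it does not vanish, the kernel is
at most as large as at v. *)
Lemma kernel_dim_ge_closed (U E : finType) N (Q : U -> E -> {mpoly K[N]})
    (deg : U -> nat) (P : ('I_N -> K) -> Prop) (v : 'I_N -> K) k :
  (forall u e, Q u e \is (deg u).-homog) -> in_closure P v ->
  (forall v', P v' -> kernel_dim_ge (fun u e => (Q u e).@[v']) k) ->
  kernel_dim_ge (fun u e => (Q u e).@[v]) k.
Proof.
move=> hQ hv hP; apply/kernel_dim_ge_rank; rewrite leqNgt; apply/negP => lt.
have evE v' : fun_mx (fun u e => (Q u e).@[v']) = map_mx (meval v') (fun_mx Q).
  by apply/matrixP => u e; rewrite !mxE.
have [r rE] : {r | \rank (fun_mx (fun u e => (Q u e).@[v])) = r} by eexists.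
rewrite rE in lt; have [f [g]] := unit_minor rE.
rewrite evE -map_mxsub unitmxE det_map_mx unitfE => /eqP; apply.
apply: (hv (\sum_i deg (enum_val (f i)))%N).
  by apply: det_dhomog => i j; rewrite !mxE.
move=> v' /hP /kernel_dim_ge_rank hr; rewrite -det_map_mx map_mxsub -evE.
apply: contraTeq hr; rewrite -unitfE -unitmxE -row_full_unit => /eqP hr.
rewrite -ltnNge (leq_trans lt) // leq_add2r -[leqLHS]hr.
rewrite mxsubrc (leq_trans (mxrankS (rowsub_sub _ _))) //.
by rewrite -[X in colsub g X]mulmx1 -mulmx_colsub mxrankM_maxl.
Qed.

(** * Dimension of a quotient of a hyperplane *)

(** The matrix is obtained by adjoining elements of W to the row space until
it fills W, which happens because the rank is bounded by N. *)
Lemma subspace_mx N (W : 'rV[K]_N -> Prop) :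
  W 0 -> (forall c u v, W u -> W v -> W (c *: u + v)) ->
  exists A : 'M[K]_N, forall v, W v <-> (v <= A)%MS.
Proof.
move=> W0 WD.
have WA (A : 'M_N) : (forall i, W (row i A)) -> forall v, (v <= A)%MS -> W v.
  move=> hA _ /submxP[u ->]; rewrite mulmx_sum_row.
  elim/big_rec: _ => // i x _; exact: WD.
suff grow k (A : 'M_N) : (N - \rank A <= k)%N -> (forall i, W (row i A)) ->
    exists B : 'M_N, forall v, W v <-> (v <= B)%MS.
  by apply: (grow N 0) => [|i]; rewrite ?leq_subr ?row0.
elim: k A => [|k IHk] A hk hA.
  exists A => v; split=> [_|]; last exact: WA.
  by apply: submx_full; rewrite -col_leq_rank -subn_eq0 -leqn0.
case: (boolp.EM (forall v, W v -> (v <= A)%MS)) => [sA|].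
  by exists A => v; split; [exact: sA|exact: WA].
move/boolp.existsNP => [v /boolp.not_implyP[Wv vA]].
apply: (IHk (A + v)%MS) => [|i].
  have : (\rank A < \rank (A + v)%MS)%N.
    rewrite (ltn_leqif (mxrank_leqif_sup (addsmxSl A v))).
    by apply/negP => h; apply: vA; apply: submx_trans h; apply: addsmxSr.
  have := rank_leq_col (A + v)%MS; lia.
have /sub_addsmxP[[x y] /= ->] := row_sub i (A + v)%MS.
rewrite addrC [y]mx11_scalar mul_scalar_mx; apply: WD => //.
by apply: WA hA _ (submxMl _ _).
Qed.

(** A hyperplane loses one dimension and W loses the k.+1 directions detected by
the functionals g, so the quotient keeps at least k of them. *)
Lemma quot_dim_ker (V : lmodType K) (T : finType) (b : T -> V)
    (F : {linear V -> K^o}) (U W : V -> Prop) k (g : 'I_k.+1 -> T -> K) :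
  (forall v, U v <-> F v = 0) ->
  (forall v, exists y : T -> K, v = \sum_t y t *: b t) ->
  W 0 -> (forall c u v, W u -> W v -> W (c *: u + v)) ->
  lin_indep g ->
  (forall s (y : T -> K), W (\sum_t y t *: b t) -> \sum_t y t * g s t = 0) ->
  exists n, quot_dim U W n /\ (k <= n)%N.
Proof.
move=> UF span W0 WD /lin_indep_row_free; set G := (X in row_free X) => /eqP rG gW.
pose comb (y : 'rV_#|T|) : V := \sum_t y 0 (enum_rank t) *: b t.
have comb_lin c u v : comb (c *: u + v) = c *: comb u + comb v.
  rewrite /comb scaler_sumr -big_split; apply: eq_bigr => t _.
  by rewrite !mxE scalerDl scalerA.
have comb0 : comb 0 = 0 by rewrite /comb big1 // => t _; rewrite mxE scale0r.
have combS n (c : 'I_n -> K) (y : 'I_n -> 'rV_#|T|) :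
    comb (\sum_l c l *: y l) = \sum_l c l *: comb (y l).
  elim/big_rec2: _ => [|l u v _ <-]; first exact: comb0.
  exact: comb_lin.
have [|c u v|A WA] := @subspace_mx _ (fun y => W (comb y)); first by rewrite comb0.
  by rewrite comb_lin; exact: WD.
pose f : 'cV[K]_#|T| := \col_t F (b (enum_val t)).
have fE y : F (comb y) = (y *m f) 0 0.
  rewrite linear_sum mxE (reindex (@enum_val _ (mem T))) /=; last exact/onW_bij/enum_val_bij.
  by apply: eq_bigr => t _; rewrite linearZ enum_valK mxE.
(* A basis of a complement of the intersection with A is a basis of the quotient. *)
pose D := (kermx f :\: A)%MS.
have rA : (\rank A + k.+1 <= #|T|)%N.
  rewrite -rG -(mxrank_tr G); apply: mulmx0_rank_max; apply/row_matrixP => i.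
  rewrite row0 row_mul; apply/rowP => s.
  have /WA /(gW s) h := row_sub i A.
  rewrite !mxE -[RHS]h.
  rewrite [RHS](reindex (@enum_val _ (mem T))) /=; last exact/onW_bij/enum_val_bij.
  by apply: eq_bigr => t _; rewrite !mxE enum_valK.
exists (\rank D); split; last first.
  have := mxrank_cap_compl (kermx f) A; rewrite mxrank_ker -/D.
  have := mxrankS (capmxSr (kermx f) A); have := rank_leq_col f.
  move: rA; lia.
exists (fun l => comb (row l (row_base D))); split=> [l|c|u /UF Fu].
- rewrite UF fE.
  have /sub_kermxP -> : (row l (row_base D) <= kermx f)%MS; last by rewrite mxE.
  by rewrite (submx_trans (row_sub _ _)) // eq_row_base diffmxSl.
- rewrite -combS => /WA.
  rewrite -[X in (X <= _)%MS](_ : (\row_l c l) *m row_base D = _); last first.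
    by rewrite mulmx_sum_row; apply: eq_bigr => l _; rewrite mxE.
  move=> cA; have : ((\row_l c l) *m row_base D <= (D :&: A))%MS.
    by rewrite sub_capmx cA andbT mulmx_sub // eq_row_base.
  rewrite capmx_diff submx0 => /eqP h l.
  have := row_free_inj (row_base_free _) (etrans h (esym (mul0mx _ _))).
  by move=> /rowP/(_ l); rewrite !mxE.
have [y uE] := span u; pose v : 'rV_#|T| := \row_t y (enum_val t).
have {}uE : u = comb v.
  by rewrite uE; apply: eq_bigr => t _; rewrite mxE enum_rankK.
have : (v <= D + A)%MS.
  apply: submx_trans (_ : kermx f <= _)%MS.
    by apply/sub_kermxP/rowP => i; rewrite ord1 -fE -uE Fu mxE.
  by rewrite -(addsmx_diff_cap_eq (kermx f) A) addsmxS // capmxSr.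
case/sub_addsmxP => -[x1 x2] /= vE.
have /submxP[c cE] : (x1 *m D <= row_base D)%MS by rewrite eq_row_base submxMl.
exists (c 0); rewrite -combS -mulmx_sum_row -cE uE.
have -> : comb v - comb (x1 *m D) = comb (x2 *m A).
  by rewrite vE -[x1 *m D]scale1r comb_lin !scale1r addrAC subrr add0r.
by apply/WA; exact: submxMl.
Qed.
End PolynomialMatrices.

(** * Homogeneous components and functionals on the Cox ring *)

Section GradedPieces.
Variables (K : fieldType) (w a : nat).
Local Notation n := (w * a.+1)%N.
Local Notation S := (cox K w a).
Local Notation U_ i j := (U_(@mxvec_index w a.+1 i j))%MM.

Lemma mcoeff_hcomp D (p : S) m : (sec (hcomp D p))@_m = (mdegree m == D)%:R * p@_m.
Proof.
rewrite [in RHS](mpolyE p) /= /hcomp_poly !(raddf_sum (mcoeff m)) /= mulr_sumr big_mkcond /=.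
apply: eq_bigr => m' _; case: ifP => mD; rewrite ?mcoeff0 !mcoeffZ mcoeffX.
  by case: (m' =P m) => [<-|]; rewrite ?mD ?mul1r ?mulr0.
by case: (m' =P m) => [<-|]; rewrite ?mD ?mul0r ?mulr0.
Qed.

Lemma mcoeff_mhomog D (p : S) m : p \in mhomog D -> mdegree m != D -> p@_m = 0.
Proof.
move=> /mhomogP hp; apply: contraNeq; rewrite -mcoeff_msupp => /hp ->; exact: eqxx.
Qed.

Lemma hcomp_mhomog D E (p : S) : p \in mhomog E -> sec (hcomp D p) = (E == D)%:R *: p.
Proof.
move=> hp; apply/mpolyP => m; rewrite mcoeff_hcomp mcoeffZ.
have [->//|mE] := eqVneq (mdegree m) E.
by rewrite (mcoeff_mhomog hp mE) !mulr0.
Qed.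

Lemma hcompZD D c (p q : S) : hcomp D (c *: p + q) = c *: hcomp D p + hcomp D q.
Proof.
apply/val_inj/mpolyP => m /=.
by rewrite mcoeffD mcoeffZ !mcoeff_hcomp mcoeffD mcoeffZ mulrDr !mulrA (mulrC c).
Qed.

Lemma mhomogX (m : 'X_{1.. n}) : 'X_[m] \in @mhomog K w a (mdegree m).
Proof. by apply/mhomogP => m'; rewrite msuppX inE => /eqP ->. Qed.

Lemma mxvec_index_eq p q (i i' : 'I_p) (j j' : 'I_q) :
  (mxvec_index i j == mxvec_index i' j') = ((i == i') && (j == j')).
Proof.
apply/eqP/andP => [|[/eqP-> /eqP->] //].
have [g gK _] := curry_mxvec_bij p q => /(congr1 g).
by rewrite (gK (i, j)) // (gK (i', j')) // => -[-> ->].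
Qed.

Lemma mdegree1 i j : @mdegree w a (U_ i j) = delta_mx 0 i.
Proof.
apply/rowP => i'; rewrite !mxE eqxx /=.
under eq_bigr do rewrite mnm1E mxvec_index_eq.
rewrite [i' == i]eq_sym; case: (eqVneq i i') => _; last by rewrite big1.
rewrite (bigD1 j) //= eqxx big1 // => j' /negPf ne.
by rewrite eq_sym ne.
Qed.

(** Bounding the total degree is what makes the monomials of multidegree L a
finite type. *)
Definition total_deg (L : 'rV[int]_w) : nat := `|(\sum_i L 0%R i)%R|%N.

Lemma mdeg_mdegree (m : 'X_{1.. n}) : mdeg m = total_deg (mdegree m).
Proof.
rewrite /total_deg mdegE; under [in RHS]eq_bigr do rewrite mxE.
rewrite -(big_morph Posz PoszD (erefl _)) absz_nat.
rewrite (reindex _ (curry_mxvec_bij _ _)) /= pair_bigA.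
by apply: eq_bigr => [[i j]].
Qed.

Definition monom (L : 'rV[int]_w) : finType :=
  {m : 'X_{1.. n < (total_deg L).+1} | mdegree (bmnm m) == L}.

Definition monom_val L (t : monom L) : 'X_{1.. n} := bmnm (val t).

Lemma monom_valP L (t : monom L) : mdegree (monom_val t) = L.
Proof. exact/eqP/(valP t). Qed.

Lemma monom_val_inj L : injective (@monom_val L).
Proof. by move=> t u tu; do 2!apply: val_inj. Qed.

Lemma monomP L m : mdegree m = L -> exists t : monom L, monom_val t = m.
Proof.
move=> mL; have hm : (mdeg m < (total_deg L).+1)%N by rewrite -mL -mdeg_mdegree.
have hL : mdegree (bmnm (BMultinom hm)) == L by rewrite /= mL.
by exists (Sub (BMultinom hm) hL).
Qed.

Lemma monom_sum L (p : S) : p \in mhomog L ->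
  p = \sum_(t : monom L) p@_(monom_val t) *: 'X_[monom_val t].
Proof.
move=> hp; apply/mpolyP => m; rewrite (raddf_sum (mcoeff m)) /=.
have [/monomP[t <-]|mL] := eqVneq (mdegree m) L.
  rewrite (bigD1 t) //= mcoeffZ mcoeffX eqxx mulr1 big1 ?addr0 // => u ut.
  by rewrite mcoeffZ mcoeffX (inj_eq (@monom_val_inj L)) (negPf ut) mulr0.
rewrite (mcoeff_mhomog hp mL) big1 // => t _; rewrite mcoeffZ mcoeffX.
by case: (monom_val t =P m) mL => [<-|]; rewrite ?monom_valP ?eqxx // mulr0.
Qed.

Definition monomH L (t : monom L) : H0 K a L := hcomp L 'X_[monom_val t].

Lemma sec_monomH L (t : monom L) : sec (monomH t) = 'X_[monom_val t].
Proof. by rewrite /monomH (hcomp_mhomog _ (mhomogX _)) monom_valP eqxx scale1r. Qed.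

Lemma H0_sum L (p : H0 K a L) : p = \sum_(t : monom L) (sec p)@_(monom_val t) *: monomH t.
Proof.
apply: val_inj; rewrite (raddf_sum val) [LHS](monom_sum (valP p)) /=.
by apply: eq_bigr => t _; congr (_ *: _); exact/esym/sec_monomH.
Qed.

(** The functional on S_L with value g t at the monomial t, extended by zero to
the other graded pieces; working on all of S avoids casts between the S_D. *)
Definition pairing L (g : monom L -> K) (p : S) : K :=
  \sum_t g t * p@_(monom_val t).

Lemma pairingZ L (g : monom L -> K) c (p : S) : pairing g (c *: p) = c * pairing g p.
Proof. by rewrite /pairing mulr_sumr; apply: eq_bigr => t _; rewrite mcoeffZ mulrCA. Qed.

Lemma pairing_sum L (g : monom L -> K) I r (P : pred I) (E : I -> S) :
  pairing g (\sum_(i <- r | P i) E i) = \sum_(i <- r | P i) pairing g (E i).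
Proof.
rewrite /pairing exchange_big; apply: eq_bigr => t _ /=.
by rewrite (raddf_sum (mcoeff _)) mulr_sumr.
Qed.

Lemma pairing_hcomp L (F : {linear H0 K a L -> K^o}) p :
  pairing (fun t => F (monomH t)) p = F (hcomp L p).
Proof.
rewrite [in RHS](H0_sum (hcomp L p)) linear_sum; apply: eq_bigr => t _.
by rewrite linearZ /= mcoeff_hcomp monom_valP eqxx mul1r mulrC.
Qed.

Lemma linear_mpoly_ext (V : lmodType K) (f h : {linear S -> V}) :
  (forall m, f 'X_[m] = h 'X_[m]) -> f =1 h.
Proof.
move=> fh p; rewrite (mpolyE p) !linear_sum; apply: eq_bigr => m _.
by rewrite !linearZ /= fh.
Qed.

Lemma hcomp_mul L E (p q : S) : q \in mhomog E ->
  sec (hcomp L (p * q)) = sec (hcomp (L - E) p) * q.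
Proof.
move=> hq; pose f (p : S) : S := sec (hcomp L (p * q)).
pose h (p : S) : S := sec (hcomp (L - E) p) * q.
have lf : linear f by move=> c u v; rewrite /f mulrDl -scalerAl hcompZD.
have lh : linear h by move=> c u v; rewrite /h hcompZD /= mulrDl -scalerAl.
pose f' := GRing.isLinear.Build K S S _ f lf.
pose fl : {linear S -> S} := HB.pack f f'.
pose h' := GRing.isLinear.Build K S S _ h lh.
pose hl : {linear S -> S} := HB.pack h h'.
apply: (linear_mpoly_ext (f := fl) (h := hl)) => m /=.
rewrite /f /h (hcomp_mhomog _ (mhomogX m)) (hcomp_mhomog _ (mhomogM (mhomogX m) hq)).
by rewrite -scalerAl [_ == L - E]eq_sym subr_eq [L == _]eq_sym.
Qed.

(** Membership in Ann(F) is tested on all of S at once: an arbitrary multiple of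
Theta meets S_L only through products of a component of degree D of Theta with
a component of degree L - D of the cofactor. *)
Lemma AnnP L (F : {linear H0 K a L -> K^o}) (Theta : S) :
  Ann F Theta <-> forall q, pairing (fun t => F (monomH t)) (Theta * q) = 0.
Proof.
have contractE D (Psi : H0 K a (L - D)) :
    contract F (hcomp D Theta) Psi = pairing (fun t => F (monomH t)) (Theta * Psi).
  rewrite pairing_hcomp; congr (F _); apply: val_inj.
  have hPsi : sec Psi \in mhomog (L - D) by exact: valP.
  rewrite [RHS](hcomp_mul L Theta hPsi).
  by rewrite opprB addrC subrK.
split=> [hA q|h D Psi]; last by rewrite contractE h.
rewrite (mpolyE q) mulr_sumr pairing_sum big1 // => m _.
rewrite -scalerAr pairingZ.
suff -> : pairing (fun t => F (monomH t)) (Theta * 'X_[m]) = 0 by rewrite mulr0.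
have := hA (L - mdegree m) (hcomp _ 'X_[m]); rewrite contractE.
by rewrite (hcomp_mhomog _ (mhomogX m)) opprB addrC subrK eqxx scale1r.
Qed.

End GradedPieces.

(** * The linear system attached to a functional *)

Section LinearSystem.
Variables (K : fieldType) (w a : nat).
Local Notation n := (w * a.+1)%N.
Local Notation S := (cox K w a).
Local Notation U_ i j := (U_(@mxvec_index w a.+1 i j))%MM.
Local Notation monom := (@monom w a).

(** The unknowns are the values of G at the monomials of degree L, and the
coefficients of A_i: the entry (i, j, l) is the coefficient of alpha_{i,l} in
A_i(alpha_{i,j}). *)
Definition unknowns L : finType := (monom L + 'I_w * 'I_a.+1 * 'I_a.+1)%type.

(** The equation alpha_{i,j} _| G = A_i(alpha_{i,j}) _| F, evaluated at every
monomial m; f lists the values of F at the monomials of degree L. *)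
Definition solution L (f : monom L -> K) (Z : unknowns L -> K) : Prop :=
  forall i j m, pairing (Z \o inl) ('X_[U_ i j + m] : S) =
    \sum_l Z (inr (i, j, l)) * pairing f 'X_[U_ i l + m].

Lemma pairingX L (g : monom L -> K) m :
  pairing g ('X_[m] : S) = \sum_t g t * (m == monom_val t)%:R.
Proof. by apply: eq_bigr => t _; rewrite mcoeffX. Qed.

Lemma pairingX0 L (g : monom L -> K) m :
  mdegree m != L -> pairing g ('X_[m] : S) = 0.
Proof.
move=> mL; rewrite pairingX big1 // => t _.
by case: (m =P monom_val t) mL => [->|]; rewrite ?mulr0 // monom_valP eqxx.
Qed.

Definition equations L : finType := ('I_w * 'I_a.+1 * monom L)%type.

(** To have finitely many equations, m is taken to be s / alpha_{i,j} with s a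
monomial of degree L.  When alpha_{i,j} does not divide s, the truncated
subtraction gives m = s, and the equation is trivial for reasons of degree. *)
Definition shift_mon L (i : 'I_w) (j l : 'I_a.+1) (s : monom L) : 'X_{1.. n} :=
  (U_ i l + (monom_val s - U_ i j))%MM.

(** The coefficients of the system, as polynomials in the values of F: constants
on the unknowns of G, linear forms on those of the A_i. *)
Definition system L (u : unknowns L) (e : equations L) : {mpoly K[#|monom L|]} :=
  let: (i, j, s) := e in
  match u with
  | inl t => (shift_mon i j j s == monom_val t)%:R%:MP
  | inr (i', j', l) => - ((i' == i) && (j' == j))%:R *:
       \sum_t (shift_mon i j l s == monom_val t)%:R *: 'X_(enum_rank t)
  end.

Definition system_deg L (u : unknowns L) : nat := if u is inl _ then 0 else 1.

Lemma system_homog L u e : @system L u e \is (system_deg u).-homog.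
Proof.
case: e => [[i j] s]; case: u => [t|[[i' j'] l]] /=.
  by rewrite -[_%:MP]mulr1 mul_mpolyC rpredZ ?dhomog1.
apply: rpredZ; apply: rpred_sum => t _; apply: rpredZ.
by rewrite dhomogX /= mdeg1.
Qed.

Lemma sum_system L (f : monom L -> K) (Z : unknowns L -> K) i j s :
  \sum_u Z u * (system u (i, j, s)).@[f \o enum_val] =
  pairing (Z \o inl) ('X_[shift_mon i j j s] : S) -
    \sum_l Z (inr (i, j, l)) * pairing f ('X_[shift_mon i j l s] : S).
Proof.
rewrite big_sumType /= pairingX; congr (_ + _).
  by apply: eq_bigr => t _; rewrite mevalC.
rewrite -sumrN.
transitivity (\sum_ij \sum_l Z (inr (ij, l)) *
    (@system L (inr (ij, l)) (i, j, s)).@[f \o enum_val]).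
  by rewrite pair_bigA; apply: eq_bigr => [[ij l]].
rewrite (bigD1 (i, j)) //= addrC big1 ?add0r => [|[i' j'] ne].
  apply: eq_bigr => l _; rewrite !eqxx mevalZ mulN1r mulrN pairingX; congr (- (_ * _)).
  rewrite (raddf_sum (meval _)) /=; apply: eq_bigr => t _.
  by rewrite mevalZ mevalXU /= enum_rankK mulrC.
apply: big1 => l _; rewrite -xpair_eqE (negPf ne) oppr0 scale0r meval0 mulr0 //.
Qed.

Lemma mdegree_shift i j l (m : 'X_{1.. n}) :
  mdegree (U_ i l + m) = mdegree (U_ i j + m).
Proof. by rewrite !mdegreeD !mdegree1. Qed.

Lemma solutionP L (f : monom L -> K) (Z : unknowns L -> K) :
  solution f Z <->
  forall e, \sum_u Z u * (system u e).@[f \o enum_val] = 0.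
Proof.
split=> [h [[i j] s]|h i j m].
  by rewrite sum_system h subrr.
have [mL|mL] := eqVneq (mdegree (U_ i j + m)) L; last first.
  rewrite pairingX0 // big1 // => l _.
  by rewrite pairingX0 ?mulr0 // (mdegree_shift _ j).
have [s sE] := monomP mL; have := h (i, j, s); rewrite sum_system /shift_mon sE.
by rewrite (addmC (U_ i j) m) addmK => /eqP; rewrite subr_eq0 (addmC m) => /eqP.
Qed.

Lemma solution_mul L (f : monom L -> K) Z i j (q : S) : solution f Z ->
  pairing (Z \o inl) ('X_(mxvec_index i j) * q) =
  pairing f ((\sum_l Z (inr (i, j, l)) *: 'X_(mxvec_index i l)) * q).
Proof.
move=> hZ; rewrite (mpolyE q) !mulr_sumr !pairing_sum; apply: eq_bigr => m _.
rewrite -!scalerAr !pairingZ; congr (_ * _).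
rewrite mulr_suml pairing_sum -mpolyXD hZ; apply: eq_bigr => l _.
by rewrite -scalerAl pairingZ mpolyXD.
Qed.

(** In a product of a variable and an element of Ann(F), replacing G by F turns
the variable into a linear form and leaves the element of Ann(F), which F
kills. *)
Lemma solution_kills L (F : {linear H0 K a L -> K^o}) Z (p : S) :
  solution (fun t => F (monomH K t) : K) Z ->
  ideal_mul (@variables_ideal K w a) (Ann F) p -> pairing (Z \o inl) p = 0.
Proof.
move=> hZ [k [c [g [hg ->]]]]; rewrite pairing_sum big1 // => s _.
have [x [y [[k' [d [h [hh ->]]]] /AnnP hy ->]]] := hg s.
rewrite mulr_suml mulr_sumr pairing_sum big1 // => s' _.
have [v ->] := hh s'; case/mxvec_indexP: v => i j.
rewrite mulrA [c s * _]mulrA [_ * 'X_ _]mulrC -!mulrA (solution_mul _ _ _ hZ).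
by rewrite !mulrA mulrC hy.
Qed.
End LinearSystem.

(** * Solutions for a combination of a+1 points *)

Section SolutionsFromPoints.
Variables (K : fieldType) (w a : nat).
Local Notation n := (w * a.+1)%N.
Local Notation S := (cox K w a).
Local Notation U_ i j := (U_(@mxvec_index w a.+1 i j))%MM.
Local Notation monom := (@monom w a).

Lemma mulr_sum_swap p q (d : K) (A : 'I_p -> K) (B : 'I_q -> K) (M : 'I_p -> 'I_q -> K) :
  d * \sum_k A k * \sum_l B l * M k l = \sum_l B l * (d * \sum_k A k * M k l).
Proof.
rewrite mulr_sumr; under eq_bigr do rewrite !mulr_sumr.
rewrite exchange_big; apply: eq_bigr => l _; rewrite !mulr_sumr.
by apply: eq_bigr => k _; ring.
Qed.

Lemma evXM (m m' : 'X_{1.. n}) (x : 'M[K]_(w, a.+1)) :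
  ev 'X_[m + m'] x = ev 'X_[m] x * ev 'X_[m'] x.
Proof. by rewrite /ev mpolyXD mevalM. Qed.

Lemma evX1 i j (x : 'M[K]_(w, a.+1)) : ev 'X_[U_ i j] x = x i j.
Proof. by rewrite /ev mevalXU mxvecE. Qed.

Lemma pairing_ev L m (x : 'M[K]_(w, a.+1)) :
  pairing (fun t : monom L => ev 'X_[monom_val t] x) ('X_[m] : S) =
  (mdegree m == L)%:R * ev 'X_[m] x.
Proof.
have [mL|mL] := eqVneq (mdegree m) L; last by rewrite pairingX0 // mul0r.
have [s <-] := monomP mL; rewrite pairingX (bigD1 s) //= eqxx mulr1 mul1r.
rewrite big1 ?addr0 // => t ts.
by rewrite (inj_eq (@monom_val_inj _ _ L)) eq_sym (negPf ts) mulr0.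
Qed.

Lemma pairing_lin L r (c : 'I_r -> K) (g : 'I_r -> monom L -> K) (p : S) :
  pairing (fun t => \sum_k c k * g k t) p = \sum_k c k * pairing (g k) p.
Proof.
rewrite /pairing; under [RHS]eq_bigr do rewrite mulr_sumr.
rewrite exchange_big; apply: eq_bigr => t _; rewrite mulr_suml.
by apply: eq_bigr => k _; rewrite mulrA.
Qed.

(** The t-th solution in the invertible case has A_i = the projector of S_{e_i}
onto the linear form dual to x_t, along the forms vanishing at x_t.  When some
Y_i is singular, the combination of the points is not concise, and this failure
itself provides the solutions. *)
Lemma points_solutions L (c : 'I_a.+1 -> K) (x : 'I_a.+1 -> 'M[K]_(w, a.+1)) :
  (0 < w)%N ->
  exists Z : 'I_a.+1 -> unknowns a L -> K, lin_indep Z /\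
    forall t, solution (fun s => \sum_k c k * ev 'X_[monom_val s] (x k)) (Z t).
Proof.
move=> w0; pose f (s : monom L) := \sum_k c k * ev 'X_[monom_val s] (x k).
rewrite -/f.
have fE m : pairing f ('X_[m] : S) =
    (mdegree m == L)%:R * \sum_k c k * ev 'X_[m] (x k).
  rewrite pairing_lin mulr_sumr; apply: eq_bigr => k _.
  by rewrite pairing_ev mulrCA.
pose Y i : 'M[K]_a.+1 := \matrix_(k, l) x k i l.
have fU i j l m : pairing f ('X_[U_ i l + m] : S) =
    (mdegree (U_ i j + m) == L)%:R * \sum_k c k * (Y i k l * ev 'X_[m] (x k)).
  rewrite fE (mdegree_shift i j l); congr (_ * _); apply: eq_bigr => k _.
  by rewrite evXM evX1 mxE.
case: (boolp.EM (forall i, Y i \in unitmx)) => [Yu|].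
  (* The column t of the inverse of Y i is the linear form with value 1 at x t
     and 0 at the other points. *)
  exists (fun t u => match u with
    | inl s => c t * ev 'X_[monom_val s] (x t)
    | inr (i, j, l) => invmx (Y i) l t * Y i t j end); split=> [d hd t|t i j m].
    pose i := Ordinal w0.
    have : invmx (Y i) *m diag_mx (\row_t d t) *m Y i = 0.
      apply/matrixP => l j; rewrite -mulmxA mul_diag_mx mxE [RHS]mxE.
      rewrite -[RHS](hd (inr (i, j, l))); apply: eq_bigr => s _.
      by rewrite !mxE mulrCA.
    move/(congr1 (fun M => Y i *m M *m invmx (Y i))).
    rewrite mulmx0 mul0mx !mulmxA mulmxV // mul1mx mulmxK //.
    by move=> /matrixP/(_ t t); rewrite !mxE eqxx mulr1n.
  pose e : monom L -> K := fun s => ev 'X_[monom_val s] (x t).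
  transitivity (c t * pairing e ('X_[U_ i j + m] : S)).
    by rewrite /pairing mulr_sumr; apply: eq_bigr => s _; rewrite mulrA.
  rewrite pairing_ev; under eq_bigr do rewrite (fU i j).
  have YV k : \sum_l invmx (Y i) l t * Y i k l = (k == t)%:R.
    have /matrixP/(_ k t) := mulmxV (Yu i); rewrite !mxE => <-.
    by apply: eq_bigr => l _; rewrite mulrC.
  rewrite evXM evX1.
  transitivity ((mdegree (U_ i j + m) == L)%:R * Y i t j *
    \sum_k (c k * ev 'X_[m] (x k)) * \sum_l invmx (Y i) l t * Y i k l).
    rewrite (bigD1 t) //= YV eqxx big1 => [|k /negPf kt]; last by rewrite YV kt mulr0.
    by rewrite addr0 mulr1 !mxE; ring.
  rewrite mulr_sum_swap; apply: eq_bigr => l _; rewrite -!mulrA; congr (_ * _).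
  rewrite mulrCA; congr (_ * (_ * _)); apply: eq_bigr => k _; ring.
move/boolp.existsNP => [i0 /negP nu].
have [th th0 hth] : exists2 th : 'cV[K]_a.+1, th != 0 & Y i0 *m th = 0.
  have /det0P[v v0 vY] : \det (Y i0)^T == 0.
    by rewrite det_tr -[_ == 0]negbK -unitfE -unitmxE.
  exists v^T; first by rewrite -(inj_eq trmx_inj) trmxK trmx0.
  by apply: trmx_inj; rewrite trmx_mul trmxK vY trmx0.
(* The t-th solution sends the t-th variable of the factor i0 to th. *)
exists (fun t u => match u with
    | inl s => 0
    | inr (i, j, l) => ((i == i0) && (j == t))%:R * th l 0 end); split=> [d hd t|t i j m].
  have /cV0Pn[l hl] := th0.
  have := hd (inr (i0, t, l)); rewrite (bigD1 t) //= !eqxx big1 ?addr0 => [|s st].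
    by move/eqP; rewrite mul1r mulf_eq0 (negPf hl) orbF => /eqP.
  by rewrite /= eq_sym (negPf st) mul0r mulr0.
rewrite /pairing [LHS]big1 => [|s _]; last by rewrite /= mul0r.
under eq_bigr do rewrite -/(pairing f _) (fU i j).
case: eqP => [->|_]; last by rewrite big1 // => l _; rewrite !mul0r.
have Yth k : \sum_l th l 0 * Y i0 k l = 0.
  have /matrixP/(_ k 0) := hth; rewrite !mxE => h; rewrite -[RHS]h.
  by apply: eq_bigr => l _; rewrite mulrC.
transitivity ((j == t)%:R * (mdegree (U_ i0 j + m) == L)%:R *
   \sum_k (c k * ev 'X_[m] (x k)) * \sum_l th l 0 * Y i0 k l).
  by rewrite [X in _ * X]big1 ?mulr0 // => k _; rewrite Yth mulr0.
rewrite mulr_sum_swap; apply: eq_bigr => l _.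
rewrite [RHS]mulrAC -[RHS]mulrA [RHS]mulrC -[RHS]mulrA mulrC -!mulrA.
congr (_ * (_ * (_ * _))).
by apply: eq_bigr => k _; ring.
Qed.

End SolutionsFromPoints.

(** * Lower bound for the number of generators *)

Section LowerBound.
Variables (K : fieldType) (w a : nat).
Local Notation n := (w * a.+1)%N.
Local Notation S := (cox K w a).
Local Notation U_ i j := (U_(@mxvec_index w a.+1 i j))%MM.
Local Notation monom := (@monom w a).
Local Notation coefs F := (fun t => F (monomH K t) : K).

Lemma solution_lin (L : 'rV[int]_w) (f : monom L -> K) r (d : 'I_r -> K)
    (Z : 'I_r -> unknowns a L -> K) :
  (forall t, solution f (Z t)) -> solution f (fun u => \sum_t d t * Z t u).
Proof.
move=> hZ i j m; rewrite [LHS](pairing_lin d (fun t => Z t \o inl)).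
under [RHS]eq_bigr do rewrite mulr_suml; rewrite exchange_big.
apply: eq_bigr => t _; rewrite (hZ t i j m) mulr_sumr.
by apply: eq_bigr => l _; rewrite mulrA.
Qed.

Lemma linear_form_mhomog i (c : 'I_a.+1 -> K) :
  (\sum_l c l *: 'X_(mxvec_index i l) : S) \in mhomog (delta_mx 0 i).
Proof.
apply: rpred_sum => l _; apply: rpredZ; rewrite -(mdegree1 i l); exact: mhomogX.
Qed.

Lemma linear_form0 i (c : 'I_a.+1 -> K) :
  (\sum_l c l *: 'X_(mxvec_index i l) : S) = 0 -> forall l, c l = 0.
Proof.
move=> /(congr1 (mcoeff (U_(mxvec_index i _)))) h l.
have := h l; rewrite mcoeff0 (raddf_sum (mcoeff _)) /= (bigD1 l) //= mcoeffZ mcoeffXU eqxx.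
rewrite mulr1 big1 ?addr0 // => l' /negPf ne.
by rewrite mcoeffZ mcoeffXU mxvec_index_eq ne andbF mulr0.
Qed.

(** If the G-part of a solution is zero, each A_i(alpha_{i,j}) is a linear form
annihilating F, hence zero by conciseness. *)
Lemma concise_lin_indep (L : 'rV[int]_w) (F : {linear H0 K a L -> K^o}) r
    (Z : 'I_r -> unknowns a L -> K) :
  concise F -> (forall t, solution (coefs F) (Z t)) -> lin_indep Z ->
  lin_indep (fun t => Z t \o inl).
Proof.
move=> hF hZ indep d hd; apply: indep => -[s|[[i j] l]]; first exact: hd.
move: l; apply: (@linear_form0 i).
apply: (hF i (MkH0 (linear_form_mhomog _ _))) => /=.
apply/AnnP => q; rewrite -(solution_mul _ j _ (solution_lin d hZ)) /pairing big1 // => s _.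
by rewrite /= [X in X * _]hd mul0r.
Qed.

(** For p of degree L only the constants have a degree that pairs with p, since
nonconstant monomials have nonzero multidegree. *)
Lemma Ann_top (L : 'rV[int]_w) (F : {linear H0 K a L -> K^o}) (p : H0 K a L) :
  Ann F (sec p) <-> F p = 0.
Proof.
have hp : sec p \in mhomog L by exact: valP.
have Fp : pairing (coefs F) (sec p) = F p.
  rewrite pairing_hcomp; congr (F _); apply: val_inj.
  by rewrite [LHS](hcomp_mhomog L hp) eqxx scale1r.
rewrite AnnP; split=> [/(_ 1)|F0 q]; first by rewrite mulr1 Fp.
rewrite (mpolyE q) mulr_sumr pairing_sum big1 // => m _.
rewrite -scalerAr pairingZ.
have [->|m0] := eqVneq m 0%MM; first by rewrite mpolyX0 mulr1 Fp F0 mulr0.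
rewrite [X in _ * X]big1 ?mulr0 // => t _.
rewrite (mcoeff_mhomog (mhomogM hp (mhomogX K m))) ?mulr0 // monom_valP.
apply: contraNneq m0 => /(congr1 (fun D => D - L)).
rewrite subrr (addrC L) addrK -mdeg_eq0 mdeg_mdegree => <-.
by rewrite /total_deg big1 // => i _; rewrite mxE.
Qed.

Lemma ideal_genZD (A : S -> Prop) c p q :
  ideal_gen A p -> ideal_gen A q -> ideal_gen A (c *: p + q).
Proof.
move=> [k1 [c1 [g1 [h1 ->]]]] [k2 [c2 [g2 [h2 ->]]]].
exists (k1 + k2)%N.
exists (fun u => match split u with inl i => c *: c1 i | inr i => c2 i end).
exists (fun u => match split u with inl i => g1 i | inr i => g2 i end); split.
  by move=> u; case: (split u).
rewrite big_split_ord scaler_sumr; congr (_ + _); apply: eq_bigr => i _.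
  by rewrite (unsplitK (inl i)) scalerAl.
by rewrite (unsplitK (inr i)).
Qed.

Lemma ideal_gen0 (A : S -> Prop) : ideal_gen A 0.
Proof.
by exists 0, (fun=> 0), (fun=> 0); split=> [[]|] //; rewrite big_ord0.
Qed.

Lemma mcoeff_comb (L : 'rV[int]_w) (y : monom L -> K) u :
  (sec (\sum_t y t *: monomH K t))@_(monom_val u) = y u.
Proof.
have -> : sec (\sum_t y t *: monomH K t) = \sum_t y t *: 'X_[monom_val t].
  transitivity (val (\sum_t y t *: monomH K t)) => //; rewrite raddf_sum.
  by apply: eq_bigr => t _ /=; congr (_ *: _); exact/sec_monomH.
rewrite (raddf_sum (mcoeff _)) (bigD1 u) //= mcoeffZ mcoeffX eqxx mulr1.
rewrite big1 ?addr0 // => t /negPf tu.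
by rewrite mcoeffZ mcoeffX (inj_eq (@monom_val_inj _ _ L)) tu mulr0.
Qed.

Lemma secant_solutions (L : 'rV[int]_w) (F : {linear H0 K a L -> K^o}) : (0 < w)%N ->
  in_secant_variety a.+1 F ->
  exists Z : 'I_a.+1 -> unknowns a L -> K,
    lin_indep Z /\ forall t, solution (coefs F) (Z t).
Proof.
move=> w0 hF.
pose P (v : 'I_#|monom L| -> K) := exists2 F' : {linear H0 K a L -> K^o},
  in_span_of_points a.+1 F' & v = (fun k => F' (monomH K (enum_val k))).
have cl : in_closure P (fun k => F (monomH K (enum_val k))).
  move=> d G hG h; apply: (hF _ _ _ (fun k => monomH K (enum_val k)) hG) => F' hF'.
  by apply: h; exists F'.
have [v' [F' [x [c [_ hF']]] ->]|Z [Zi hZ]] :=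
  kernel_dim_ge_closed (@system_homog K w a L) cl (k := a.+1).
  have [Z [Zi hZ]] := points_solutions L c x w0; exists Z; split=> // t e.
  have /solutionP/(_ e) h := hZ t; rewrite -[RHS]h; apply: eq_bigr => u _.
  congr (_ * _); apply: meval_eq => k /=; rewrite hF'.
  by apply: eq_bigr => k' _; rewrite sec_monomH.
by exists Z; split=> // t; apply/solutionP => e; exact: hZ.
Qed.

Lemma min_gens_ge (L : 'rV[int]_w) (F : {linear H0 K a L -> K^o}) : (0 < w)%N ->
  concise F -> in_secant_variety a.+1 F ->
  exists r, num_min_gens (Ann F) L r /\ (a <= r)%N.
Proof.
move=> w0 hc /(secant_solutions w0) [Z [Zi hZ]].
apply: (quot_dim_ker (b := @monomH K w a L) (F := F) (g := fun t => Z t \o inl)).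
- exact: Ann_top.
- by move=> v; exists (fun t => (sec v)@_(monom_val t)); exact: H0_sum.
- exact: ideal_gen0.
- by move=> c u v; exact: ideal_genZD.
- exact: concise_lin_indep hc hZ Zi.
move=> s y /(solution_kills (hZ s)) h; rewrite -[RHS]h; apply: eq_bigr => t _.
by rewrite mcoeff_comb mulrC.
Qed.
End LowerBound.

(** On a point there are no variables, so every functional is a multiple of the
evaluation. *)
Lemma border_rank_point (K : fieldType) a (L : 'rV[int]_0)
    (F : {linear @H0 K 0 a L -> K^o}) r : has_border_rank F r -> (r <= 1)%N.
Proof.
case=> _; apply=> N d G s _; apply.
exists (fun _ => 0), (fun _ => \sum_t F (monomH K t)); split=> [_ []//|p].
rewrite big_ord1 [in LHS](H0_sum p) linear_sum mulr_suml; apply: eq_bigr => t _.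
rewrite linearZ mulrC; congr (_ * _).
by rewrite /ev [sec p]nvar0_mpolyC mevalC mcoeffC !nvar0_mnmE eqxx mulr1.
Qed.

(** There are no variables, so the ideal m is zero, and any nonzero functional
serves as the one vanishing on (m Ann(F))_L. *)
Lemma num_min_gens_point (K : fieldType) a (L : 'rV[int]_0)
    (F : {linear @H0 K 0 a L -> K^o}) : exists r, num_min_gens (Ann F) L r.
Proof.
have [t0 _] : exists t : monom a L, monom_val t = 0%MM.
  by apply: monomP; apply/rowP => -[].
have W0 p : ideal_mul (@variables_ideal K 0 a) (Ann F) p -> p = 0.
  move=> [k [c [g [hg ->]]]]; rewrite big1 // => s _.
  have [x [y [[k' [d [h [hh ->]]]] _ ->]]] := hg s.
  by rewrite [\sum_(i < k') _]big1 ?mul0r ?mulr0 // => s' _; have [[]] := hh s'.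
have [|||||s y|r [hr _]] := quot_dim_ker (U := fun p : H0 K a L => Ann F (sec p))
    (W := fun p => ideal_mul (@variables_ideal K 0 a) (Ann F) (sec p))
    (b := @monomH K 0 a L) (F := F) (g := fun (_ : 'I_1) _ => 1); last by exists r.
- exact: Ann_top.
- by move=> v; exists (fun t => (sec v)@_(monom_val t)); exact: H0_sum.
- exact: ideal_gen0.
- by move=> c u v; exact: ideal_genZD.
- by move=> c /(_ t0); rewrite big_ord1 mulr1 => h t; rewrite ord1.
move=> /W0 h; rewrite big1 // => t _.
by rewrite mulr1 -(mcoeff_comb y t) h mcoeff0.
Qed.

Theorem theorem5p4 (R : realType) (w a : nat) (L : 'rV[int]_w)
    (F : {linear @H0 R[i] w a L -> R[i]^o})
    (hL : @very_ample R[i] w a L)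
    (hconcise : concise F)
    (hrank : has_border_rank F a.+1) :
  exists n : nat, num_min_gens (Ann F) L n /\ (a <= n)%N.
Proof.
have [w0|] := posnP w; last by move=> w0; exact: min_gens_ge w0 hconcise hrank.1.
subst w; have [r hr] := num_min_gens_point F; exists r; split=> //.
have := border_rank_point hrank; rewrite ltnS leqn0 => /eqP ->; exact: leq0n.
Qed.
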